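(* Let $n$ be an odd natural number and let $\mathcal{P}$ be a non-self-dual chiral $n$-polytope with simple Petrie polygons. Then $\mathcal{O}(\mathcal{P})$ (defined below) is an alternating semiregular polyhedron with trivial facet stabilizer, and its symmetry type graph is isomorphic to the premaniplex $\mathcal{A}_n$ described below.
   Context: Graphs may have semi-edges and parallel edges. An $n$-premaniplex is a connected graph with edges colored by $\{0,\dots,n-1\}$, each vertex (flag) incident to exactly one edge of each color, and alternating paths of length 4 in colors $i,j$ closed for $|i-j|>1$; an $n$-maniplex is a simple $n$-premaniplex. $r_i\Phi$ is the flag joined to $\Phi$ by its color-$i$ edge. The $i$-faces are the components after deleting the color-$i$ edges (vertices, edges, facets for $i=0,1,n-1$). Automorphisms are color-preserving graph automorphisms. An abstract $n$-polytope is an $n$-maniplex such that whenever two flags are joined by a path with colors in $[0,m]$ and by one with colors in $[k,n-1]$, they are joined by a path with colors in $[k,m]$; a polyhedron is a 3-polytope. Chiral: exactly two flag orbits under automorphisms, adjacent flags in different orbits. Self-dual: isomorphic to the maniplex obtained by recoloring $i\mapsto n-1-i$. A Petrie polygon is an orbit of flags under $r_{n-1}\cdots r_1r_0$; simple if distinct flags in it lie in distinct vertices. Let $\mathcal{Y}_n$ be the family-1 premaniplex: an $n$-gon (2-premaniplex with $2n$ flags in a cycle alternating colors 0,1) with chosen flag $y_0$ and 1-faces $e_i=\{(r_1r_0)^iy_0,\ r_0(r_1r_0)^iy_0\}$, $0\le i\le n-1$, with an added edge of color 2 joining the two flags of each $e_i$. The operation $\mathcal{O}$: for an $n$-premaniplex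 $\mathcal{P}$, $\mathcal{O}(\mathcal{P})$ is the 3-premaniplex with flag set $\{(\Psi,y)\}$, $\Psi$ a flag of $\mathcal{P}$ and $y$ a flag of $\mathcal{Y}_n$, with $r_0(\Psi,y)=(\Psi,r_0y)$, $r_1(\Psi,y)=(\Psi,r_1y)$, and $r_2(\Psi,y)=(r_j\Psi,r_0y)$ where $e_j$ is the 1-face of $\mathcal{Y}_n$ containing $y$. The premaniplex $\mathcal{A}_n$: two $n$-gons with chosen flags $a$ (outer) and $b$ (inner), with edges of color 2 joining $(r_1r_0)^ia$ with $r_0(r_1r_0)^ib$ and $r_0(r_1r_0)^ia$ with $(r_1r_0)^ib$ for each $0\le i\le n-1$. The symmetry type graph of a maniplex has its flag orbits as vertices with an edge of color $i$ between the orbits of $\Phi$ and $r_i\Phi$ (semi-edge if equal). A polyhedron is semiregular if its automorphism group is transitive on vertices (facets being polygons, hence regular); it is alternating semiregular if moreover it has exactly two orbits of facets and any two flags joined by an edge of color 2 lie in facets of different orbits. Trivial facet stabilizer: only the identity automorphism maps a facet to itself. *)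

(* Defs.v *)
From mathcomp Require Import all_boot.
From mathcomp Require Import boolp classical_sets.

Set Implicit Arguments.
Unset Strict Implicit.
Unset Printing Implicit Defensive.

Local Open Scope classical_set_scope.

(** An edge-coloured graph in which every vertex (flag) is incident to exactly
    one edge of each of the [n] colours amounts to a family of involutions:
    [r i x] is the other end of the edge of colour [i] at [x].  A fixed point of
    [r i] is a semi-edge; [r i x = r j x] with [i != j] is a pair of parallel
    edges or semi-edges.  Flag sets may be infinite. *)
Record flag_graph (n : nat) := FlagGraph {
  flag :> Type;
  r : 'I_n -> flag -> flag;
  rK : forall i, involutive (r i) }.

Section Notions.
Context (n : nat) (G : flag_graph n).
Implicit Types (x y : G) (i j k m : 'I_n).

(** The end of the path that starts at [x] and follows the colours of [w],
    from the head of [w] to its tail. *)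
Definition walk x (w : seq 'I_n) : G := foldl (fun z i => r i z) x w.

Definition joined (C : pred 'I_n) x y : Prop :=
  exists2 w : seq 'I_n, all C w & walk x w = y.

Definition is_premaniplex : Prop :=
  [/\ [set: G] !=set0,
      forall x y, joined predT x y &
      forall i j, (i.+1 < j) || (j.+1 < i) ->
        forall x, r i (r j (r i (r j x))) = x].

Definition is_maniplex : Prop :=
  [/\ is_premaniplex,
      forall i x, r i x <> x &
      forall i j, i != j -> forall x, r i x <> r j x].

(** When [m < k] the interval of colours [k, m] is empty, and the last path is
    the trivial one. *)
Definition is_polytope : Prop :=
  is_maniplex /\
  forall k m x y,
    joined [pred i : 'I_n | i <= m] x y ->
    joined [pred i : 'I_n | k <= i] x y ->
    joined [pred i : 'I_n | k <= i <= m] x y.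

(** The rank [i] is a plain number, so that [face 0] and [face n.-1] (vertices
    and facets) make sense for a variable [n]. *)
Definition face (i : nat) x : set G :=
  [set y | joined [pred j : 'I_n | j != i :> nat] x y].

Definition faces (i : nat) : set (set G) := range (face i).

(** One step applies [r 0] first and [r n.-1] last. *)
Definition petrie_step x : G := walk x (enum 'I_n).

Definition petrie_polygon x : set G :=
  [set y | exists k : nat, iter k petrie_step x = y \/ iter k petrie_step y = x].

Definition simple_petrie_polygons : Prop :=
  forall Q, range petrie_polygon Q ->
  forall x y, Q x -> Q y -> x <> y -> face 0 x <> face 0 y.

End Notions.

Arguments faces {n} G i _.

Definition isomorphism n (G H : flag_graph n) (f : G -> H) : Prop :=
  bijective f /\ forall i x, f (r i x) = r i (f x).

Definition isomorphic n (G H : flag_graph n) : Prop :=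
  exists f : G -> H, isomorphism f.

Definition dual n (G : flag_graph n) : flag_graph n :=
  @FlagGraph n G (fun i => @r n G (rev_ord i)) (fun i => @rK n G (rev_ord i)).

Definition self_dual n (G : flag_graph n) : Prop := isomorphic G (dual G).

Definition exactly_two T (S : set T) : Prop :=
  exists a b : T, a <> b /\ S = [set a; b].

Section Symmetry.
Context (n : nat) (G : flag_graph n).

Definition automorphism : set (G -> G) := [set f | isomorphism f].

Definition flag_orbit (x : G) : set G := [set f x | f in automorphism].

Definition flag_orbits : set (set G) := range flag_orbit.

Definition chiral : Prop :=
  exactly_two flag_orbits /\
  forall i (x : G), flag_orbit x <> flag_orbit (r i x).

Definition face_orbit (F : set G) : set (set G) :=
  [set f @` F | f in automorphism].

Definition face_orbits (i : nat) : set (set (set G)) :=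
  [set face_orbit F | F in faces G i].

Lemma r_flag_orbit i x : r i @` flag_orbit x = flag_orbit (r i x).
Proof.
apply/seteqP; split=> [_ [_ [f fA <-] <-]|_ [f fA <-]].
  by exists f => //; rewrite (proj2 fA).
by exists (f x); [exists f|rewrite (proj2 fA)].
Qed.

Definition stg_flag : Type := {O : set G | flag_orbits O}.

Lemma stg_r_subproof i (O : stg_flag) : flag_orbits (r i @` sval O).
Proof. by case: O => S /= [x _ <-]; exists (r i x); rewrite // r_flag_orbit. Qed.

Definition stg_r i (O : stg_flag) : stg_flag :=
  exist _ (r i @` sval O) (stg_r_subproof i O).

Lemma stg_rK i : involutive (stg_r i).
Proof.
move=> [S S_orb]; apply: eq_exist => /=.
apply/seteqP; split=> [_ [_ [x Sx <-] <-]|x Sx].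
  by rewrite rK.
by exists (r i x); [exists x|rewrite rK].
Qed.

(** The orbit of [r i x] is the image under [r i] of the orbit of [x]
    ([r_flag_orbit]). *)
Definition symmetry_type_graph : flag_graph n := FlagGraph stg_rK.

End Symmetry.

Arguments face_orbits {n} G i _.

(** The facets of a polyhedron are polygons, hence regular, so semiregularity
    reduces to vertex-transitivity. *)
Definition semiregular (G : flag_graph 3) : Prop :=
  forall V W, faces G 0 V -> faces G 0 W ->
  exists2 f, automorphism f & f @` V = W.

Definition alternating_semiregular (G : flag_graph 3) : Prop :=
  [/\ semiregular G,
      exactly_two (face_orbits G 2) &
      forall x : G,
        face_orbit (face 2 x) <> face_orbit (face 2 (r (inord 2) x))].

Definition trivial_facet_stabilizer (G : flag_graph 3) : Prop :=
  forall F f, faces G 2 F -> automorphism f -> f @` F = F ->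
  forall x, f x = x.

Section Rank3.
Context (T : Type) (f0 f1 f2 : T -> T).
Context (f0K : involutive f0) (f1K : involutive f1) (f2K : involutive f2).

Definition r3 (i : 'I_3) : T -> T :=
  match i : nat with 0 => f0 | 1 => f1 | _ => f2 end.

Lemma r3_0 : r3 (inord 0) = f0. Proof. by rewrite /r3 inordK. Qed.
Lemma r3_1 : r3 (inord 1) = f1. Proof. by rewrite /r3 inordK. Qed.
Lemma r3_2 : r3 (inord 2) = f2. Proof. by rewrite /r3 inordK. Qed.

Lemma r3K i : involutive (r3 i).
Proof. by rewrite /r3; case: i => [[|[|i]]]. Qed.

Definition flag_graph_rank3 : flag_graph 3 := FlagGraph r3K.

End Rank3.

(** The flags of an [n]-gon with base flag [y0]: [(i, false)] stands for
    [(r1 r0)^i y0] and [(i, true)] for [r0 (r1 r0)^i y0].  Thus the edge [e_i]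
    consists of the two flags with first component [i]. *)
Definition gon (n : nat) : Type := ('I_n * bool)%type.

Definition gon_r0 n (y : gon n) : gon n := (y.1, ~~ y.2).

Definition gon_r1 n (y : gon n) : gon n :=
  if y.2 then (ordS y.1, false) else (ord_pred y.1, true).

Lemma gon_r0K n : involutive (@gon_r0 n).
Proof. by case=> i b; rewrite /gon_r0 /= negbK. Qed.

Lemma gon_r1K n : involutive (@gon_r1 n).
Proof. by case=> i [] /=; rewrite /gon_r1 /= ?ordSK ?ord_predK. Qed.

Definition premaniplex_Y n : flag_graph 3 :=
  flag_graph_rank3 (@gon_r0K n) (@gon_r1K n) (@gon_r0K n).

Section Operation.
Context (n : nat) (P : flag_graph n).

Definition O_flag : Type := (P * premaniplex_Y n)%type.

Definition O_r0 (x : O_flag) : O_flag := (x.1, r (inord 0) x.2).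
Definition O_r1 (x : O_flag) : O_flag := (x.1, r (inord 1) x.2).
Definition O_r2 (x : O_flag) : O_flag := (r x.2.1 x.1, r (inord 0) x.2).

Lemma O_r0K : involutive O_r0.
Proof. by case=> x y; congr pair; exact: rK. Qed.

Lemma O_r1K : involutive O_r1.
Proof. by case=> x y; congr pair; exact: rK. Qed.

Lemma O_r2K : involutive O_r2.
Proof. by case=> x y; rewrite /O_r2 /= r3_0 /= rK gon_r0K. Qed.

Definition operation_O : flag_graph 3 := flag_graph_rank3 O_r0K O_r1K O_r2K.

End Operation.

(** The first component tells the outer [n]-gon ([false], base flag [a]) from
    the inner one ([true], base flag [b]). *)
Definition A_r0 n (x : bool * gon n) : bool * gon n := (x.1, gon_r0 x.2).
Definition A_r1 n (x : bool * gon n) : bool * gon n := (x.1, gon_r1 x.2).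
Definition A_r2 n (x : bool * gon n) : bool * gon n := (~~ x.1, gon_r0 x.2).

Lemma A_r0K n : involutive (@A_r0 n).
Proof. by case=> c y; rewrite /A_r0 /= gon_r0K. Qed.

Lemma A_r1K n : involutive (@A_r1 n).
Proof. by case=> c y; rewrite /A_r1 /= gon_r1K. Qed.

Lemma A_r2K n : involutive (@A_r2 n).
Proof. by case=> c y; rewrite /A_r2 /= gon_r0K negbK. Qed.

Definition premaniplex_A n : flag_graph 3 :=
  flag_graph_rank3 (@A_r0K n) (@A_r1K n) (@A_r2K n).

(* Main.v *)
Require Import Defs.
From mathcomp Require Import all_boot.
From mathcomp Require Import boolp classical_sets.

(** A facet of [O(P)] is an [n]-gon attached to a flag of [P], and a vertex of
    [O(P)] amounts to a Petrie polygon of [P]; simplicity of the Petrie polygons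
    gives the intersection property.  An automorphism of [O(P)] moves all the
    [n]-gons by one and the same dihedral symmetry, which recolours [P] along the
    cycle [0, 1, ..., n.-1].  The colours [n.-1] and [0] commute, whereas no two
    consecutive colours of a chiral polytope do, so the recolouring is trivial or
    is a duality.  Without self-duality, the automorphisms of [O(P)] are thus those
    of [P], acting on the first component.  As [n] is odd, one Petrie step swaps
    the two flag orbits of [P], whence vertex-transitivity. *)

Set Implicit Arguments.
Unset Strict Implicit.
Unset Printing Implicit Defensive.

Local Open Scope classical_set_scope.

(** * Paths, faces and propagation along edges *)

Section Paths.
Context (n : nat) (G : flag_graph n).
Implicit Types (x y z : G) (C : pred 'I_n) (w : seq 'I_n).

Lemma walk_cat x w1 w2 : walk x (w1 ++ w2) = walk (walk x w1) w2.
Proof. exact: foldl_cat. Qed.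

Lemma walk_rcons x w i : walk x (rcons w i) = r i (walk x w).
Proof. by rewrite -cats1 walk_cat. Qed.

Lemma walk_revK x w : walk (walk x w) (rev w) = x.
Proof.
elim: w x => [//|i w IHw] x.
by rewrite rev_cons walk_rcons IHw rK.
Qed.

Lemma walkK_rev x w : walk (walk x (rev w)) w = x.
Proof. by rewrite -{2}(revK w) walk_revK. Qed.

Lemma joined_refl C x : joined C x x.
Proof. by exists [::]. Qed.

Lemma joined_r C i x y : C i -> joined C x y -> joined C x (r i y).
Proof.
by move=> Ci [w wC <-]; exists (rcons w i); rewrite ?walk_rcons ?all_rcons ?Ci.
Qed.

Lemma joined_sym C x y : joined C x y -> joined C y x.
Proof. by case=> w wC <-; exists (rev w); rewrite ?all_rev ?walk_revK. Qed.

Lemma joined_trans C y x z : joined C x y -> joined C y z -> joined C x z.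
Proof.
by move=> [v vC <-] [w wC <-]; exists (v ++ w); rewrite ?all_cat ?vC ?walk_cat.
Qed.

Lemma sub_joined (C D : pred 'I_n) x y :
  (forall i, C i -> D i) -> joined C x y -> joined D x y.
Proof. by move=> CD [w wC <-]; exists w => //; apply: sub_all wC. Qed.

Lemma joined_ind (Q : G -> Prop) C x y :
  (forall i z, C i -> Q z -> Q (r i z)) -> Q x -> joined C x y -> Q y.
Proof.
move=> QS Qx [w wC <-]; elim: w x Qx wC => [//|i w IHw] x Qx /= /andP[Ci wC].
by apply: IHw => //; apply: QS.
Qed.

Lemma face_eq i x y : face i x y -> face i x = face i y.
Proof.
move=> xy; apply/seteqP; split=> z; last exact: joined_trans xy.
exact: joined_trans (joined_sym xy).
Qed.

Lemma face_self i x : face i x x.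
Proof. exact: joined_refl. Qed.

(** The rule [S] carries agreement at [x] across every edge; for [S z i = r i z] this is the
    rigidity of automorphisms. *)
Lemma connected_ext T (f g : G -> T) (S : T -> 'I_n -> T) x :
    is_premaniplex G ->
    (forall i z, f (r i z) = S (f z) i) -> (forall i z, g (r i z) = S (g z) i) ->
  f x = g x -> f =1 g.
Proof.
move=> [_ conn _] fS gS fgx y.
by apply: (joined_ind (Q := fun z => f z = g z)) (conn x y) => // i z _; rewrite fS gS => ->.
Qed.

End Paths.

(** * Automorphisms, flag orbits and face orbits *)

Section Automorphisms.
Context (n : nat) (G : flag_graph n).
Implicit Types (x y z : G) (f g : G -> G).

Lemma walk_morph (H : flag_graph n) (f : G -> H) x w :
  (forall i z, f (r i z) = r i (f z)) -> f (walk x w) = walk (f x) w.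
Proof. by move=> fr; elim: w x => [//|i w IHw] x /=; rewrite IHw fr. Qed.

Lemma automorphism_id : automorphism (@idfun G).
Proof. by split=> //; exists idfun. Qed.

Lemma automorphism_comp f g :
  automorphism f -> automorphism g -> automorphism (f \o g).
Proof.
move=> [fB fr] [gB gr]; split; first exact: bij_comp.
by move=> i x /=; rewrite gr fr.
Qed.

Lemma automorphism_inv f :
  automorphism f -> exists2 g, automorphism g & cancel f g /\ cancel g f.
Proof.
move=> [[g fK gK] fr]; exists g => //; split; first by exists f.
by move=> i x; apply: (can_inj fK); rewrite fr !gK.
Qed.

Lemma flag_orbitP x y :
  flag_orbit x = flag_orbit y <-> exists2 f, automorphism f & f x = y.
Proof.
split=> [xy|[f fA <-]].
  have : flag_orbit y y by exists idfun => //; apply: automorphism_id.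
  by rewrite -xy => -[f fA fx]; exists f.
have [g gA [fK gK]] := automorphism_inv fA.
apply/seteqP; split=> _ [h hA <-].
  by exists (h \o g) => /=; rewrite ?fK //; apply: automorphism_comp.
by exists (h \o f) => //; apply: automorphism_comp.
Qed.

Lemma automorphism_face f i x :
  automorphism f -> f @` face i x = face i (f x).
Proof.
move=> fA; have [_ fr] := fA; have [g [_ gr] [_ gK]] := automorphism_inv fA.
apply/seteqP; split=> [_ [y [w wi <-] <-]|_ [w wi <-]].
  by exists w => //; rewrite walk_morph.
by exists (walk x w); [exists w|rewrite walk_morph].
Qed.

Lemma face_orbitP (E F : set G) :
  face_orbit E = face_orbit F <-> exists2 f, automorphism f & f @` E = F.
Proof.
split=> [EF|[f fA <-]].
  have : face_orbit F F by exists idfun; [exact: automorphism_id|exact: image_id].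
  by rewrite -EF => -[f fA fE]; exists f.
have [g gA [fK gK]] := automorphism_inv fA.
apply/seteqP; split=> _ [h hA <-].
  exists (h \o g); first exact: automorphism_comp.
  by rewrite image_comp; apply: eq_imagel => x _ /=; rewrite fK.
exists (h \o f); first exact: automorphism_comp.
by rewrite image_comp.
Qed.

Lemma automorphism_fix f x :
  is_premaniplex G -> automorphism f -> f x = x -> f =1 idfun.
Proof.
move=> Gpm [_ fr] fx; apply: (@connected_ext _ _ _ f idfun (fun z i => r i z)) fx => //.
Qed.

(* A connected flag graph is the coset graph of the stabilizer of any flag. *)
Lemma automorphism_stab x y :
    is_premaniplex G ->
    (forall w, walk x w = x <-> walk y w = y) ->
  exists2 f, automorphism f & f x = y.
Proof.
move=> [_ conn _] stab.
have path (a z : G) : {w | walk a w = z}.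
  by apply: cid; have [w _ <-] := conn a z; exists w.
pose t (a b : G) z := walk b (sval (path a z)).
(* As the same walks close up at [a] and at [b], the path chosen in [t] does not matter. *)
have tE (a b : G) w : (forall v, walk a v = a <-> walk b v = b) ->
    t a b (walk a w) = walk b w.
  move=> ab; rewrite /t; case: (path a _) => v /= vw.
  have : walk b (v ++ rev w) = b by apply/ab; rewrite walk_cat vw walk_revK.
  by rewrite walk_cat => {2}<-; rewrite walkK_rev.
have tK (a b : G) : (forall v, walk a v = a <-> walk b v = b) -> cancel (t a b) (t b a).
  move=> ab z; have [w wz] := path a z; rewrite -wz tE // tE // => v.
  by rewrite ab.
exists (t x y); last by rewrite -[x in t _ _ x]/(walk x [::]) tE.
split; first by exists (t y x); apply: tK => // v; rewrite stab.
move=> i z; have [w <-] := path x z.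
by rewrite -walk_rcons !tE // walk_rcons.
Qed.

End Automorphisms.

(** * Intersection property and chirality *)

Lemma polytope_cut n (G : flag_graph n) (j j' : 'I_n) (x y : G) :
    is_polytope G -> j < j' ->
    joined [pred i : 'I_n | i <= j] x y ->
    joined [pred i : 'I_n | j' <= i] x y -> x = y.
Proof.
move=> [_ Gpol] jj' xy1 xy2; have [w wC <-] := Gpol _ _ _ _ xy1 xy2.
case: w wC => [//|i w] /= /andP[/andP[j'i ij] _].
by have := leq_trans jj' (leq_trans j'i ij); rewrite ltnn.
Qed.

Section Chiral.
Context (n : nat) (G : flag_graph n).
Hypothesis Gchiral : chiral G.
Implicit Types (x y z : G).

(** Chirality as a proper 2-colouring: [c] records which of the two orbits contains a flag. *)
Lemma chiral_two_coloring :
  exists c : G -> bool,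
    [/\ forall x y, c x = c y <-> exists2 f, automorphism f & f x = y,
        forall i x, c (r i x) = ~~ c x &
        forall d, exists x, c x = d].
Proof.
case: Gchiral => -[a [b [ab orbE]]] adj.
have orb x : flag_orbit x = a \/ flag_orbit x = b.
  by have : flag_orbits (flag_orbit x) by [exists x]; rewrite orbE.
exists (fun x => `[< flag_orbit x = a >]).
split=> [x y|i x|].
- rewrite -flag_orbitP; split=> [cxy|->//].
  case: (asboolP (flag_orbit x = a)) cxy => xa; case: asboolP => ya //.
    by rewrite xa ya.
  by case: (orb x) (orb y) => [//|->] [//|->].
- have aT : `[< a = a >] by apply/asboolP.
  have bF : `[< b = a >] = false by apply/asboolP; apply: nesym.
  by have := adj i x; case: (orb x) (orb (r i x)) => -> [] -> //; rewrite aT bF.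
case.
  have : flag_orbits a by rewrite orbE; left.
  by case=> x _ xa; exists x; apply/asboolP.
have : flag_orbits b by rewrite orbE; right.
by case=> x _ xb; exists x; apply/asboolP; rewrite xb; apply: nesym.
Qed.

(* An automorphism swapping [x] and [r i x] would exist if [r i] were central
   in the connection group. *)
Lemma chiral_r_not_central (i : 'I_n) :
  ~ (forall k x, r i (r k x) = r k (r i x)).
Proof.
move=> rC; have [[a [b [_ orbE]]] adj] := Gchiral.
have [x _ _] : flag_orbits a by rewrite orbE; left.
apply: (adj i x); apply/flag_orbitP; exists (r i) => //.
by split=> //; exists (r i); apply: rK.
Qed.

(* If [r j] and [r j'] commuted, then the flag graph would be the product of its
   components in the colours [<= j] and [>= j'].  An automorphism taking [x] to
   [r 0 (r j' x)] could then be restricted to the first factor, which would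
   give one taking [x] to [r 0 x]. *)
Lemma chiral_polytope_noncommuting (j j' : 'I_n) :
  is_polytope G -> j' = j.+1 :> nat -> ~ (forall x, r j (r j' x) = r j' (r j x)).
Proof.
move=> Gpol j'E jC; have [[Gpm _ _] _] := Gpol; have [_ _ alt] := Gpm.
have [c [cP cr cex]] := chiral_two_coloring.
pose A : pred 'I_n := [pred i : 'I_n | i <= j].
pose B : pred 'I_n := [pred i : 'I_n | j' <= i].
have AB i : B i = ~~ A i by rewrite /A /B /= j'E ltnNge.
have rC i k x : A i -> B k -> r i (r k x) = r k (r i x).
  rewrite /A /B /= j'E => ij jk.
  have [ik|ki] := ltnP i.+1 k.
    by rewrite -[in RHS](alt i k _ x) ?ik // !rK.
  have -> : i = j by apply/val_inj/eqP; rewrite eqn_leq ij -ltnS (leq_trans jk).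
  have -> // : k = j'.
  apply/val_inj/eqP; rewrite eqn_leq /= j'E jk andbT.
  exact: leq_trans ki _.
have swapA i x w : A i -> all B w -> r i (walk x w) = walk (r i x) w.
  move=> Ai; elim: w x => [//|k w IHw] x /= /andP[Bk wB].
  by rewrite IHw // rC.
have swapB k x w : B k -> all A w -> r k (walk x w) = walk (r k x) w.
  move=> Bk; elim: w x => [//|i w IHw] x /= /andP[Ai wA].
  by rewrite IHw // -rC.
have splitAB x w : walk x w = walk (walk x (filter A w)) (filter B w).
  elim: w x => [//|i w IHw] x; rewrite [walk x _]/= [filter B _]/= AB IHw.
  by case: (boolP (A i)) => Ai /=; rewrite ?Ai // (negPf Ai) swapB ?filter_all ?AB.
(* If the whole walk closes, the end of its [A] part is joined to [x] both by colours in [A] and by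
   colours in [B], hence equals [x]. *)
have stabAB x w :
    walk x w = x <-> walk x (filter A w) = x /\ walk x (filter B w) = x.
  rewrite splitAB; split=> [wx|[-> ->] //].
  suff E : x = walk x (filter A w) by rewrite -E in wx *.
  have jj' : j < j' by rewrite j'E.
  apply: polytope_cut Gpol jj' _ _.
    by exists (filter A w) => //; exact: (filter_all A).
  apply: joined_sym; exists (filter B w) => //; exact: (filter_all B).
have n0 : 0 < n := leq_ltn_trans (leq0n j) (ltn_ord j).
pose i0 := Ordinal n0.
have [x _] := cex true.
have [f [fB fr] fx] : exists2 f, automorphism f & f x = r i0 (r j' x).
  by apply/cP; rewrite !cr negbK.
have Ai0 : A i0 by [].
have Bj' : B j' by rewrite /B /=.
have [f' f'A f'x] : exists2 f, automorphism f & f x = r i0 x.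
  apply: (automorphism_stab Gpm) => w.
  have -> := stabAB x w; have -> := stabAB (r i0 x) w.
  have wA : all A (filter A w) by apply: filter_all.
  have wB : all B (filter B w) by apply: filter_all.
  (* Since [r j'] commutes with walks in [A], [f] compares those closed at [x] and at [r i0 x]. For
     walks in [B], [r i0] itself does so. *)
  have stabA : walk x (filter A w) = x <-> walk (r i0 x) (filter A w) = r i0 x.
    have fwx : f (walk x (filter A w)) = r j' (walk (r i0 x) (filter A w)).
      by rewrite walk_morph // fx rC // swapB.
    split=> [wx|wx].
      by apply: (can_inj (rK j')); rewrite -fwx wx fx rC.
    by apply: (bij_inj fB); rewrite fwx wx fx -rC.
  have stabB : walk x (filter B w) = x <-> walk (r i0 x) (filter B w) = r i0 x.
    by rewrite -swapA //; split=> [->|/(can_inj (rK i0))].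
  by rewrite stabA stabB.
have : c (r i0 x) = c x by apply/esym/cP; exists f'.
by rewrite cr; case: (c x).
Qed.

End Chiral.

(** * Petrie polygons *)

Section Petrie.
Context (n : nat) (P : flag_graph n).
Implicit Types (x y z : P) (i j k : 'I_n).

Lemma petrie_step_inj : injective (@petrie_step n P).
Proof.
move=> x y xy; rewrite -(walk_revK x (enum 'I_n)) -(walk_revK y (enum 'I_n)).
by rewrite -!/(petrie_step _) xy.
Qed.

Lemma petrie_polygon_step x y : petrie_polygon x (petrie_step y) <-> petrie_polygon x y.
Proof.
split=> -[[|k] []].
- by move=> /= xE; exists 1; right.
- by move=> /= yE; exists 1; right.
- by move=> /= /petrie_step_inj kE; exists k; left.
- by move=> kE; exists k.+2; right; rewrite iterSr.
- by move=> /= <-; exists 1; left.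
- by move=> /= <-; exists 1; left.
- by move=> /= <-; exists k.+2; left.
- by rewrite iterSr => kE; exists k; right.
Qed.

Lemma walk_takeS x i :
  walk x (take i.+1 (enum 'I_n)) = r i (walk x (take i (enum 'I_n))).
Proof.
by rewrite (take_nth i) ?size_enum_ord // walk_rcons nth_ord_enum.
Qed.

Lemma walk_rev_takeS x i :
  walk (r i x) (rev (take i.+1 (enum 'I_n))) = walk x (rev (take i (enum 'I_n))).
Proof.
by rewrite (take_nth i) ?size_enum_ord // nth_ord_enum rev_rcons /= rK.
Qed.

Lemma drop_enum_ord_geq m : all (fun k : 'I_n => m <= k) (drop m (enum 'I_n)).
Proof.
apply/allP => k; rewrite -(mem_map val_inj) map_drop val_enum_ord drop_iota.
by rewrite mem_iota => /andP[].
Qed.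

Lemma take_enum_ord_ltn m : all (fun k : 'I_n => k < m) (take m (enum 'I_n)).
Proof.
apply/allP => k; rewrite -(mem_map val_inj) map_take val_enum_ord take_iota.
by rewrite mem_iota /= add0n => /leq_trans-> //; apply: geq_minl.
Qed.

(** The colours of a Petrie step that come after [i] are positive, so they keep the vertex. *)
Lemma face_petrie_step x i :
  face 0 (petrie_step x) = face 0 (walk x (take i.+1 (enum 'I_n))).
Proof.
apply/esym/face_eq; exists (drop i.+1 (enum 'I_n)); last first.
  by rewrite -walk_cat cat_take_drop.
by apply: sub_all (drop_enum_ord_geq i.+1) => k /=; case: (val k).
Qed.

(** For [i < j], equal ends would join the two flags of the last edge, of colour [j], by colours
    below [j]; the intersection property would make it a semi-edge. *)
Lemma petrie_walk_inj x i j :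
    is_polytope P ->
  walk x (take i.+1 (enum 'I_n)) = walk x (take j.+1 (enum 'I_n)) -> i = j.
Proof.
move=> Ppol.
wlog: i j / i < j => [IH|ij].
  case: (ltngtP i j) => [ij|ji|/val_inj//]; first exact: IH.
  by move=> /esym /(IH _ _ ji).
have j1 : j.-1 < n := leq_ltn_trans (leq_pred j) (ltn_ord j).
have j0 : 0 < j := leq_ltn_trans (leq0n i) ij.
have [[_ rfix _] _] := Ppol.
rewrite [in RHS]walk_takeS => ijE; case: (rfix j (walk x (take j (enum 'I_n)))).
have below m : m <= j ->
    joined [pred k : 'I_n | k <= Ordinal j1] x (walk x (take m (enum 'I_n))).
  move=> mj; exists (take m (enum 'I_n)) => //.
  apply: sub_all (take_enum_ord_ltn m) => k /= km.
  by rewrite -ltnS prednK // (leq_trans km).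
apply: (polytope_cut (j := Ordinal j1) (j' := j) Ppol); first by rewrite /= prednK.
  by rewrite -ijE; apply: joined_trans (joined_sym (below _ ij)) (below _ (leqnn j)).
by apply/joined_sym/joined_r => //=; apply: joined_refl.
Qed.

End Petrie.

(** * The n-gon and its symmetries *)

Section Gon.
Context (n : nat).
Implicit Types (i j : 'I_n) (u v : gon n).

Lemma val_iter_ordS k i : iter k (@ordS n) i = (i + k) %% n :> nat.
Proof.
elim: k => [|k IHk]; first by rewrite addn0 modn_small.
by rewrite iterS /= IHk -addn1 modnDml addn1 addnS.
Qed.

Lemma ord_pred_rev i : ord_pred (rev_ord i) = rev_ord (ordS i).
Proof.
apply: (can_inj (@ordSK n)); rewrite ord_predK; apply: val_inj => /=.
have := ltn_ord i; rewrite leq_eqVlt => /orP[/eqP iE|i1].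
  by rewrite iE modnn subnn subn1 prednK ?modnn // -iE.
rewrite (modn_small i1) -subSn // subSS modn_small // ltn_subrL /=.
exact: leq_ltn_trans (leq0n i) (ltn_ord i).
Qed.

(** Connectedness of the n-gon as an induction principle: [gon_r0] followed by [gon_r1] advances the
    index of [(i, false)] cyclically. *)
Lemma gon_ind (Q : gon n -> Prop) u :
    Q u -> (forall v, Q v -> Q (gon_r0 v)) -> (forall v, Q v -> Q (gon_r1 v)) ->
  forall v, Q v.
Proof.
move=> Qu Q0 Q1.
have Qtrue i : Q (i, false) -> Q (i, true) by move/Q0.
have [i Qi] : exists i, Q (i, false).
  by case: u Qu => i [] Qi; exists i => //; apply: (Q0 _ Qi).
have Qfalse j : Q (j, false).
  (* Going through [n] avoids a truncated difference [j - i]. *)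
  have <- : iter (n - i + j) (@ordS n) i = j.
    apply: val_inj; rewrite /= val_iter_ordS addnA subnKC; last exact: ltnW.
    by rewrite modnDl modn_small.
  by elim: (n - i + j) => [//|k IHk]; apply: (Q1 _ (Qtrue _ IHk)).
by case=> j []; [apply: Qtrue|]; apply: Qfalse.
Qed.

(** Both generators flip the second component, so [h] reverses orientation everywhere or nowhere;
    this constant [d] tells whether [s] acts as a reflection or a rotation. *)
Lemma gon_morphP (h : gon n -> gon n) :
    (forall u, h (gon_r0 u) = gon_r0 (h u)) ->
    (forall u, h (gon_r1 u) = gon_r1 (h u)) ->
  exists (d : bool) (s : 'I_n -> 'I_n),
    (forall u, h u = (s u.1, u.2 (+) d)) /\
    (forall i, s (ordS i) = if d then ord_pred (s i) else ordS (s i)).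
Proof.
move=> h0 h1.
pose s i := (h (i, false)).1.
have hE i : h (i, false) = (s i, (h (i, false)).2) by exact: surjective_pairing.
have hE' i : h (i, true) = (s i, ~~ (h (i, false)).2).
  by rewrite -[(i, true)]/(@gon_r0 n (i, false)) h0 hE.
case: (posnP n) => [n0|n0].
  have no (i : 'I_n) : False by move: (leq_ltn_trans (leq0n i) (ltn_ord i)); rewrite n0.
  by exists false, id; split=> [[i]|i]; case: (no i).
pose o := Ordinal n0; pose d := (h (o, false)).2; exists d, s.
have hd u : (h u).2 = u.2 (+) d.
  have r1_2 v : (gon_r1 v).2 = ~~ v.2 by case: v => i [].
  apply: (gon_ind (u := (o, false)) (Q := fun u => (h u).2 = _)) => [//|v|v] vE.
    by rewrite h0 /= vE -addNb.
  by rewrite h1 !r1_2 vE -addNb.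
split=> [[i []]|i] /=; first by rewrite hE' hd.
  by rewrite hE hd.
by rewrite /s -[(ordS i, _)]/(gon_r1 (i, true)) h1 hE' hd /gon_r1 /=; case: d hd.
Qed.

End Gon.

(** * Facets, vertices and the intersection property of [operation_O P] *)

Section Operation.
Context (n : nat) (P : flag_graph n).
Implicit Types (Psi : P) (x y : operation_O P) (u v : gon n) (i j : 'I_n).

Lemma operation_rE (c : 'I_3) x :
  r c x = (if c == 2 :> nat then r x.2.1 x.1 else x.1,
           if c == 1 :> nat then gon_r1 x.2 else gon_r0 x.2).
Proof.
by case: c => [[|[|[|//]]] c3]; rewrite /= /O_r0 /O_r1 /O_r2 /= ?r3_0 ?r3_1.
Qed.

Lemma joined_gon (C : pred 'I_3) Psi u v :
  C (inord 0) -> C (inord 1) -> joined C ((Psi, u) : operation_O P) (Psi, v).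
Proof.
move=> C0 C1; apply: (gon_ind (u := u) (Q := fun v =>
  joined C ((Psi, u) : operation_O P) (Psi, v))) => [|w|w]; first exact: joined_refl.
  by move=> /(joined_r C0); rewrite operation_rE inordK.
by move=> /(joined_r C1); rewrite operation_rE inordK.
Qed.

Lemma operation_facet x y : face 2 x y <-> x.1 = y.1.
Proof.
split; last first.
  by case: x y => [Psi u] [_ v] /= <-; apply: joined_gon; rewrite /= inordK.
apply: (joined_ind (Q := fun y => x.1 = y.1)) => // c z c2 ->.
by rewrite operation_rE (negPf (c2 : c != 2 :> nat)).
Qed.

(** A step of colour [i] in [P] lifts: walk round the n-gon to the edge [e_i], then cross it by
    colour 2. *)
Lemma joined_operation Psi Psi' u v :
  joined predT Psi Psi' -> joined predT ((Psi, u) : operation_O P) (Psi', v).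
Proof.
move=> PsiJ; apply: (joined_ind (Q := fun Psi' => forall v,
  joined predT ((Psi, u) : operation_O P) (Psi', v))) PsiJ _; last first.
  by move=> w; apply: joined_gon.
move=> i Theta _ IH w.
have := joined_r (i := inord 2) (isT : predT _) (IH (i, false)).
rewrite operation_rE inordK //= => ThetaJ.
by apply: joined_trans ThetaJ _; apply: joined_gon.
Qed.

(** For [n > 1] the cyclic successor has no fixed point. *)
Lemma gon_r0_neq_r1 u : 1 < n -> gon_r0 u <> gon_r1 u.
Proof.
move=> n1; have ordS_neq i : ordS i <> i.
  move=> /(congr1 val) /= iE; have := ltn_ord i.
  rewrite leq_eqVlt => /orP[/eqP nE|lt]; last first.
    by move: iE; rewrite modn_small // => /esym /n_Sn.
  have i0 : 0 = i by rewrite -iE nE modnn.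
  by move: n1; rewrite -nE -i0.
case: u => i []; rewrite /gon_r0 /gon_r1 /= => -[iE]; first exact: (ordS_neq i).
by apply: (ordS_neq (ord_pred i)); rewrite ord_predK.
Qed.

Lemma operation_maniplex : 1 < n -> is_maniplex P -> is_maniplex (operation_O P).
Proof.
move=> n1 [[[Psi _] conn _] rfix _].
have n0 := ltnW n1.
split; first split.
- by exists (Psi, (Ordinal n0, false)).
- by move=> [Psi1 u] [Psi2 v]; apply: joined_operation.
- move=> c d cd [Theta [i b]]; rewrite !operation_rE.
  by case: c d cd => [[|[|[|//]]] c3] [[|[|[|//]]] d3] //= _; rewrite /gon_r0 /= !negbK ?rK.
- move=> c [Theta u]; rewrite operation_rE; case: c => [[|[|[|//]]] c3] /= [].
  + by case: u => i [].
  + by case: u => i [].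
  + by move=> /rfix.
- have r01 u : gon_r0 u <> gon_r1 u := gon_r0_neq_r1 n1.
  move=> c d cd [Theta u]; rewrite !operation_rE.
  case: c d cd => [[|[|[|//]]] c3] [[|[|[|//]]] d3] //= _.
  + by move=> [/r01].
  + by move=> [/esym /rfix].
  + by move=> [/esym/r01].
  + by move=> [_ /esym/r01].
  + by move=> [/rfix].
  + by move=> [_ /r01].
Qed.

(** Numbers the vertices of the n-gon: vertex [i] consists of [(i, true)] and [(ordS i, false)],
    which [gon_r1] swaps. *)
Definition vertex_index (u : gon n) : 'I_n := if u.2 then u.1 else ord_pred u.1.

Lemma vertex_index_r1 u : vertex_index (gon_r1 u) = vertex_index u.
Proof. by case: u => i []; rewrite /vertex_index /gon_r1 //= ordSK. Qed.

Lemma vertex_index_inj u v :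
  vertex_index u = vertex_index v -> v = u \/ v = gon_r1 u.
Proof.
case: u v => [i []] [j []]; rewrite /vertex_index /gon_r1 /= => ij.
- by left; rewrite ij.
- by right; rewrite ij ord_predK.
- by right; rewrite ij.
- by left; rewrite (can_inj (@ord_predK n) ij).
Qed.

(* The flags of the vertex of [(Psi, u)] are obtained from the flags of one
   Petrie polygon; this is the one from which [Psi] is reached with the colours
   [0, ..., vertex_index u]. *)
Definition petrie_base x : P :=
  walk x.1 (rev (take (vertex_index x.2).+1 (enum 'I_n))).

Lemma walk_petrie_base x :
  walk (petrie_base x) (take (vertex_index x.2).+1 (enum 'I_n)) = x.1.
Proof. exact: walkK_rev. Qed.

(** For [i > 0] the two bases coincide; at [i = 0] the index wraps round and they differ by one full
    Petrie step. *)
Lemma petrie_base_r2 Psi Psi' i :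
  petrie_polygon Psi (petrie_base (r i Psi', (i, true)))
  <-> petrie_polygon Psi (petrie_base (Psi', (i, false))).
Proof.
rewrite /petrie_base /= /vertex_index /= walk_rev_takeS.
case: (posnP i) => i0; last first.
  have -> // : (ord_pred i).+1 = i.
  have i1 : i.-1 < n := leq_ltn_trans (leq_pred i) (ltn_ord i).
  by rewrite /= -{1}(prednK i0) addSn /= modnDr modn_small // prednK.
have -> : (ord_pred i).+1 = n.
  have n0 : 0 < n := leq_ltn_trans (leq0n i) (ltn_ord i).
  by rewrite /= i0 add0n modn_small prednK.
rewrite i0 take0 /= take_oversize ?size_enum_ord //.
by rewrite -(petrie_polygon_step _ (walk _ (rev _))) /petrie_step walkK_rev.
Qed.

Lemma petrie_base_vertex x y :
  face 0 x y -> petrie_polygon (petrie_base x) (petrie_base y).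
Proof.
apply: (joined_ind (Q := fun y => petrie_polygon (petrie_base x) (petrie_base y))).
  move=> c [Theta u] c0; rewrite operation_rE; case: c c0 => [[|[|[|//]]] c3] //= _.
    by rewrite /petrie_base /= vertex_index_r1.
  case: u => i []; rewrite /gon_r0 /=; last by rewrite petrie_base_r2.
  by rewrite -{1}(rK i Theta) petrie_base_r2.
by exists 0; left.
Qed.

(** The bases of [x] and [y] lie on one Petrie polygon, and their successors on it lie in the vertex
    of [x.1 = y.1]. Simplicity makes the bases equal, and [petrie_walk_inj] then makes the indices
    equal. *)
Lemma operation_facet_vertex x y :
    is_polytope P -> simple_petrie_polygons P ->
  face 2 x y -> face 0 x y -> y = x \/ y = r (inord 1) x.
Proof.
move=> Ppol Psimple /operation_facet xy1 /petrie_base_vertex xyP.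
have baseE : petrie_base x = petrie_base y.
  apply: petrie_step_inj; apply: contrapT => neq.
  apply: (Psimple (petrie_polygon (petrie_base x))) neq _.
  - by exists (petrie_base x).
  - by rewrite petrie_polygon_step; exists 0; left.
  - by rewrite petrie_polygon_step.
  - rewrite (face_petrie_step _ (vertex_index x.2)) (face_petrie_step _ (vertex_index y.2)).
    by rewrite !walk_petrie_base xy1.
have idxE : vertex_index x.2 = vertex_index y.2.
  apply: petrie_walk_inj (petrie_base x) _ _ Ppol _.
  by rewrite walk_petrie_base xy1 baseE walk_petrie_base.
rewrite operation_rE inordK //.
case: x y xy1 idxE {xyP baseE} => [Psi u] [_ v] /= <- /vertex_index_inj[]->.
  by left.
by right.
Qed.

End Operation.

Lemma joined_one_color n (G : flag_graph n) (C : pred 'I_n) i (x y : G) :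
  (forall k, C k -> k = i) -> joined C x y -> y = x \/ y = r i x.
Proof.
move=> Ci; apply: (joined_ind (Q := fun y => y = x \/ y = r i x)); last by left.
by move=> k z /Ci -> [->|->]; [right|left; rewrite rK].
Qed.

(** Only [k >= 1] with [m <= 1] is not immediate. There the flags share a facet and a vertex, so
    they are equal or joined by colour 1; if 1 is outside the interval, simplicity of the maniplex
    excludes the latter. *)
Lemma operation_polytope n (P : flag_graph n) :
  1 < n -> is_polytope P -> simple_petrie_polygons P -> is_polytope (operation_O P).
Proof.
move=> n1 Ppol Psimple; have Omax := operation_maniplex n1 (proj1 Ppol).
split=> // k m x y xym xyk; have [_ rfix rneq] := Omax.
have [m1|m2] := leqP m 1; last first.
  apply: sub_joined xyk => i /= ->.
  by rewrite (leq_trans _ m2) // -ltnS.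
have [k0|k1] := posnP k.
  by apply: sub_joined xym => i /= ->; rewrite k0.
have xy2 : face 2 x y.
  by apply: sub_joined xym => i /= im; rewrite neq_ltn (leq_ltn_trans im).
have xy0 : face 0 x y.
  by apply: sub_joined xyk => i /= ki; rewrite -lt0n (leq_trans k1).
case: (operation_facet_vertex Ppol Psimple xy2 xy0) => yE.
  by rewrite yE; apply: joined_refl.
have one (c : 'I_3) (C : pred 'I_3) : c != inord 1 -> (forall i, C i -> i = c) ->
    joined C x y -> False.
  move=> c1 Cc /(joined_one_color Cc) [] yE'; first by apply: (rfix (inord 1) x); rewrite -yE.
  by apply: (rneq c (inord 1) c1 x); rewrite -yE.
have [m0|m1'] := posnP m.
  case: (one ord0 _ _ _ xym); first by rewrite -val_eqE /= inordK.
  by move=> i /=; rewrite m0 leqn0 => /eqP ?; apply: val_inj.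
have [k1'|k2] := leqP k 1; last first.
  case: (one ord_max _ _ _ xyk); first by rewrite -val_eqE /= inordK.
  move=> i /= ki; apply: val_inj; apply/eqP.
  by rewrite eqn_leq /= -ltnS ltn_ord (leq_trans k2).
rewrite yE; apply: joined_r (joined_refl _ _).
by rewrite /= inordK // k1'.
Qed.

(** * Automorphisms of [operation_O P] *)

Lemma operation_lift n (P : flag_graph n) (phi : P -> P) :
  automorphism phi ->
  automorphism ((fun x => (phi x.1, x.2)) : operation_O P -> operation_O P).
Proof.
move=> phiA; have [_ phir] := phiA; have [psi _ [phiK psiK]] := automorphism_inv phiA.
split; first by exists (fun x => (psi x.1, x.2)) => -[Psi u] /=; rewrite ?phiK ?psiK.
move=> c x; rewrite !operation_rE /=.
by case: eqP => // _; rewrite phir.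
Qed.

Section OperationAutomorphisms.
Context (n : nat) (P : flag_graph n).
Hypotheses (n2 : 2 < n) (Ppol : is_polytope P) (Pchiral : chiral P).
Hypothesis Pdual : ~ self_dual P.

(* The colours [n.-1] and [0] commute, while
   consecutive colours do not, so [s] fixes the edge [{n.-1, 0}]: it is the
   identity or the reversal, and the latter would make [phi] a duality. *)
Lemma operation_recoloring (phi : P -> P) (d : bool) (s : 'I_n -> 'I_n) :
    bijective phi -> (forall i x, phi (r i x) = r (s i) (phi x)) ->
    (forall i, s (ordS i) = if d then ord_pred (s i) else ordS (s i)) ->
  d = false /\ s =1 id.
Proof.
move=> phiB phir sS; have n0 : 0 < n by apply: ltn_trans n2.
have n1 : n.-1 < n by rewrite prednK.
pose o := Ordinal n0; pose l := Ordinal n1.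
have lo : ordS l = o by apply: val_inj; rewrite /= prednK // modnn.
have iterE (i : 'I_n) : iter i (@ordS n) o = i.
  by apply: val_inj; rewrite /= val_iter_ordS add0n modn_small.
have [[[_ _ alt] _ _] _] := Ppol.
(* [phi] transports the commutation of the colours 0 and [n.-1], which are not consecutive as
   [n > 2]. *)
have comm (x : P) : r (s o) (r (s l) x) = r (s l) (r (s o) x).
  have [psi _ psiK] := phiB; rewrite -(psiK x) -!phir; congr phi.
  rewrite -[in RHS](alt o l _ (psi x)) ?rK //.
  by rewrite /= ltn_predRL n2.
have ordS_val (i : 'I_n) : i.+1 < n -> ordS i = i.+1 :> nat.
  by move=> i1; rewrite /= modn_small.
have wrap (i : 'I_n) : ~~ (i.+1 < n) -> i = l.
  move=> i1; apply: val_inj; apply/eqP; rewrite eqn_leq /= -ltnS prednK // ltn_ord /=.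
  by rewrite -ltnS prednK // leqNgt.
have := sS l; rewrite lo; case: d sS => sS sE.
  have slE : s l = ordS (s o) by rewrite sE ord_predK.
  case: (boolP ((s o).+1 < n)) => [so|/wrap so].
    case: (chiral_polytope_noncommuting Pchiral Ppol (j := s o) (j' := s l)) => //.
    by rewrite slE ordS_val.
  (* Here [s o = l] and [s] runs backwards, so it is [rev_ord]. *)
  case: Pdual; exists phi; split=> // i x; rewrite phir.
  suff -> : s i = rev_ord i by [].
  rewrite -(iterE i); elim: (val i) => [|k IHk] /=.
    by rewrite so; apply: val_inj; rewrite /= subn1.
  by rewrite sS IHk ord_pred_rev.
case: (boolP ((s l).+1 < n)) => [sl|/wrap sl].
  case: (chiral_polytope_noncommuting Pchiral Ppol (j := s l) (j' := s o)) => //.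
  by rewrite sE ordS_val.
split=> // i; rewrite -(iterE i); elim: (val i) => [|k IHk] /=.
  by rewrite sE sl lo.
by rewrite sS IHk.
Qed.

Lemma operation_automorphismP f :
    automorphism (f : operation_O P -> operation_O P) ->
  exists2 phi, automorphism phi & forall x, f x = (phi x.1, x.2).
Proof.
move=> fA; have [fB fr] := fA.
have [[Ppm _ _] _] := Ppol; have [[Psi0 _] conn _] := Ppm.
have n0 : 0 < n by apply: ltn_trans n2.
pose u0 : gon n := (Ordinal n0, false).
pose phi Psi := (f (Psi, u0)).1.
pose h Psi u : gon n := (f (Psi, u)).2.
have fE Psi u : f (Psi, u) = (phi Psi, h Psi u).
  rewrite [LHS]surjective_pairing; congr pair.
  apply/esym/operation_facet; rewrite -[face 2 _](automorphism_face _ _ fA).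
  by exists (Psi, u) => //; apply/operation_facet.
have h0 Psi u : h Psi (gon_r0 u) = gon_r0 (h Psi u).
  by have := fr (inord 0) (Psi, u); rewrite !operation_rE inordK //= !fE => -[].
have h1 Psi u : h Psi (gon_r1 u) = gon_r1 (h Psi u).
  by have := fr (inord 1) (Psi, u); rewrite !operation_rE inordK //= !fE => -[].
have [phi2 h2] : (forall Psi u, phi (r u.1 Psi) = r (h Psi u).1 (phi Psi)) /\
    (forall Psi u, h (r u.1 Psi) (gon_r0 u) = gon_r0 (h Psi u)).
  by split=> Psi u; have := fr (inord 2) (Psi, u);
    rewrite !operation_rE inordK //= !fE => -[].
(* Crossing an edge by colour 2 shows that [h] agrees at adjacent flags on one flag of the n-gon,
   hence on all of them. *)
have hE Psi : h Psi =1 h Psi0.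
  apply: (joined_ind (Q := fun Psi => h Psi =1 h Psi0)) (conn Psi0 Psi) => // i Theta _ IH.
  apply: (gon_ind (u := (i, true)) (Q := fun v => h _ v = h _ v)) => [|v|v].
  - by have := h2 Theta (i, false); rewrite /= => ->; rewrite IH -h0.
  - by rewrite !h0 => ->.
  - by rewrite !h1 => ->.
have [d [s [hds sS]]] := gon_morphP (h0 Psi0) (h1 Psi0).
(* The inverse reads off [g] on the image [h Psi0 u0] of the base flag, which is the same for all
   facets. *)
have phiB : bijective phi.
  have [g fK gK] := fB.
  exists (fun Psi => (g (Psi, h Psi0 u0)).1) => Psi.
    by rewrite -(hE Psi) -fE fK.
  have := gK (Psi, h Psi0 u0); rewrite [g _]surjective_pairing fE.
  by case.
have phir i Psi : phi (r i Psi) = r (s i) (phi Psi).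
  by have := phi2 Psi (i, false); rewrite hE hds.
have [d0 sid] := operation_recoloring phiB phir sS.
exists phi; first by split=> // i Psi; rewrite phir sid.
by case=> Psi u; rewrite fE hE hds sid d0 addbF -surjective_pairing.
Qed.

End OperationAutomorphisms.

(** * Odd rank, vertex-transitivity and the symmetry type graph *)

Lemma chiral_odd_rank n (P : flag_graph n) : odd n -> chiral P -> 2 < n.
Proof.
case: n P => [//|[|[//|n]]] // P _ Pchiral; exfalso.
(* In rank 1 the single generator is central. *)
by apply: (chiral_r_not_central Pchiral (i := ord0)) => k x; rewrite !ord1.
Qed.

(* Going round a vertex of [O(P)] alternates the two orbits of [P] at each step,
   and brings the index back after an odd number [n] of steps. *)
Lemma operation_vertex_meets n (P : flag_graph n) (c : P -> bool) (o : 'I_n) :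
    odd n -> (forall i x, c (r i x) = ~~ c x) ->
  forall (x : operation_O P) d,
  exists2 Psi, face 0 x (Psi, (o, true)) & c Psi = d.
Proof.
move=> nodd cr x d.
have [Psi [i xPsi]] : exists Psi i, face 0 x (Psi, (i, true)).
  case: x => Psi [i []]; first by exists Psi, i; apply: face_self.
  exists (r i Psi), i.
  have := joined_r (i := inord 2) (_ : [pred c : 'I_3 | c != 0 :> nat] _)
    (face_self 0 ((Psi, (i, false)) : operation_O P)).
  by rewrite operation_rE /= inordK // => /(_ isT).
have turn k : exists2 Psi', face 0 x (Psi', (iter k (@ordS n) i, true)) &
    c Psi' = c Psi (+) odd k.
  elim: k => [|k [Theta xTheta cTheta]]; first by exists Psi; rewrite ?addbF.
  exists (r (iter k.+1 (@ordS n) i) Theta); last by rewrite cr cTheta /= addbN.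
  have c1 : [pred c : 'I_3 | c != 0 :> nat] (inord 1) by rewrite /= inordK.
  have c2 : [pred c : 'I_3 | c != 0 :> nat] (inord 2) by rewrite /= inordK.
  have := joined_r c2 (joined_r c1 xTheta).
  by rewrite !operation_rE !inordK.
have iterE m : m %% n = 0 -> iter (m + (n - i) + o) (@ordS n) i = o.
  move=> mn; apply: val_inj; rewrite /= val_iter_ordS addnA addnCA.
  rewrite subnKC ?(ltnW (ltn_ord i)) //.
  by rewrite -modnDml modnDr mn add0n modn_small.
(* [n - i + o] steps bring the index from [i] to [o]; one extra full turn, of odd length [n],
   corrects the colour if needed. *)
have [e] : exists e : bool, c Psi (+) odd (e * n + (n - i) + o) = d.
  exists (c Psi (+) odd ((n - i) + o) (+) d).
  rewrite -addnA oddD oddM nodd andbT oddb.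
  by case: (c Psi) (odd _) d => [] [] [].
have [Theta xTheta cTheta] := turn (e * n + (n - i) + o) => cE.
exists Theta; last by rewrite cTheta.
by move: xTheta; rewrite iterE // modnMl.
Qed.

Theorem theorem9p3 (n : nat) (P : flag_graph n) :
  odd n ->
  is_polytope P ->
  chiral P ->
  ~ self_dual P ->
  simple_petrie_polygons P ->
  [/\ is_polytope (operation_O P),
      alternating_semiregular (operation_O P),
      trivial_facet_stabilizer (operation_O P) &
      isomorphic (symmetry_type_graph (operation_O P)) (premaniplex_A n)].
Proof.
move=> nodd Ppol Pchiral Pdual Psimple.
have n2 := chiral_odd_rank nodd Pchiral.
have n0 : 0 < n by apply: ltn_trans n2.
have Opol := operation_polytope (ltnW n2) Ppol Psimple.
have Oaut := operation_automorphismP n2 Ppol Pchiral Pdual.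
have [c [cP cr cex]] := chiral_two_coloring Pchiral.
have [[Ppm _ _] _] := Ppol.
(* A flag orbit is thus given by an orbit of [P] and a flag of the n-gon, the data of a flag of
   [premaniplex_A n]. *)
have OautP (x y : operation_O P) :
    (exists2 f, automorphism f & f x = y) <-> c x.1 = c y.1 /\ x.2 = y.2.
  split=> [[f /Oaut[phi phiA fE] <-]|[/cP[phi phiA phixy] xy2]].
    by rewrite fE; split=> //; apply/cP; exists phi.
  exists (fun z => (phi z.1, z.2)); first exact: operation_lift.
  by rewrite phixy xy2 -surjective_pairing.
have OfacetP (x y : operation_O P) :
    face_orbit (face 2 x) = face_orbit (face 2 y) <-> c x.1 = c y.1.
  rewrite face_orbitP; split=> [[f fA]|cxy].
    rewrite automorphism_face // => fxy.
    have /operation_facet <- : face 2 (f x) y by rewrite fxy; apply: face_self.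
    have [phi phiA ->] := Oaut _ fA.
    by apply/cP; exists phi.
  have [f fA fxy] : exists2 f, automorphism f & f x = ((y.1, x.2) : operation_O P).
    by apply/OautP.
  exists f => //; rewrite automorphism_face // fxy.
  by apply/face_eq/operation_facet.
have [x0 cx0] := cex false; have [x1 cx1] := cex true.
pose rep (d : bool) := if d then x1 else x0.
have crep d : c (rep d) = d by case: d.
pose flag_o Psi : operation_O P := (Psi, (Ordinal n0, true)).
split=> //.
- split.
  + move=> _ _ [x _ <-] [y _ <-].
    (* Both vertices contain flags with the same colour and the same n-gon flag, and these lie in
       one orbit. *)
    have [Psi xPsi cPsi] := operation_vertex_meets (Ordinal n0) nodd cr x true.
    have [Theta yTheta cTheta] := operation_vertex_meets (Ordinal n0) nodd cr y true.
    rewrite (face_eq xPsi) (face_eq yTheta).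
    have [f fA fE] : exists2 f, automorphism f &
        f (flag_o Psi) = flag_o Theta.
      by apply/OautP; rewrite /= cPsi cTheta.
    by exists f => //; rewrite automorphism_face // fE.
  + pose F d := face_orbit (face 2 (flag_o (rep d))).
    exists (F false), (F true); split; first by move/OfacetP; rewrite /= cx0 cx1.
    apply/seteqP; split=> [_ [_ [x _ <-] <-]|_ [] ->].
    * have -> : face_orbit (face 2 x) = F (c x.1) by apply/OfacetP; rewrite crep.
      by case: (c x.1); [right|left].
    * by eexists; [eexists|].
    * by eexists; [eexists|].
  + move=> x /OfacetP; rewrite operation_rE inordK //= cr.
    by case: (c x.1).
- move=> _ f [x _ <-] fA fx y.
  have [phi phiA fE] := Oaut _ fA; rewrite fE.
  (* All flags of a facet have the same first component, so [phi] has a fixed flag and rigidity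
     applies. *)
  have phix : phi x.1 = x.1.
    have /operation_facet : face 2 x (f x).
      by rewrite -fx automorphism_face //; apply: face_self.
    by rewrite fE.
  by rewrite (automorphism_fix Ppm phiA phix) -surjective_pairing.
- pose orb (x : operation_O P) : symmetry_type_graph (operation_O P) :=
    exist _ (flag_orbit x) (ex_intro2 _ _ x I erefl).
  have orbP (O : symmetry_type_graph (operation_O P)) : {x | orb x = O}.
    apply: cid; case: O => S Sorb; have [x _ xS] := Sorb.
    by exists x; apply: eq_exist.
  have orb_eq x y : orb x = orb y <-> c x.1 = c y.1 /\ x.2 = y.2.
    rewrite -OautP -flag_orbitP; split=> [/(congr1 sval) //|xy].
    exact: eq_exist.
  have orb_r i x : r i (orb x) = orb (r i x).
    by apply: eq_exist; apply: r_flag_orbit.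
  (* The orbit of [x.1] selects the outer or inner n-gon; colour 2 switches it because [c] is a
     proper colouring. *)
  pose lab (x : operation_O P) : premaniplex_A n := (c x.1, x.2).
  have lab_r i x : lab (r i x) = r i (lab x).
    rewrite /lab operation_rE.
    by case: i => [[|[|[|//]]] i3]; rewrite /= /A_r2 //= cr.
  pose F O := lab (sval (orbP O)).
  have FE x : F (orb x) = lab x.
    by rewrite /F; case: (orbP _) => y /= /orb_eq[cxy xy]; rewrite /lab cxy xy.
  exists F; split.
    exists (fun a => orb (rep a.1, a.2)) => [O|[d u]].
      have [x <-] := orbP O; rewrite FE; apply/orb_eq => /=.
      by rewrite crep.
    by rewrite FE /lab /= crep.
  move=> i O; have [x <-] := orbP O.
  by rewrite orb_r !FE lab_r.
Qed.
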